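(* Let $n\ge1$, let $x=(x_1,\dots,x_{2n})$ be indeterminates and let $b$ be a nonzero parameter. Then $$A^{(2)}_{\mathrm{OO}}(4n;x;\zeta_4,b,b)=2^{-2n^2+2n}\prod_{i=1}^{2n}x_i^{-2n+1}\prod_{1\le i<j\le2n}(1+x_i^2x_j^2).$$
   Context: $\sigma(t)=t-t^{-1}$, $\zeta_4=\sqrt{-1}$. For parameters $a,b,c$ let $M_{\mathrm{OO}}(n;x;a,b,c)$ be the skew-symmetric $2n\times2n$ matrix with entries $\sigma(x_j/x_i)\Big(\dfrac{c^2}{\sigma(ax_ix_j)}+\dfrac{b^2}{\sigma(a/(x_ix_j))}\Big)$, let $F_{\mathrm{OD}}(n;x;a)=\dfrac{\prod_{1\le i<j\le2n}\sigma(ax_ix_j)\sigma(a/(x_ix_j))}{\prod_{1\le i<j\le2n}\sigma(x_j/x_i)}$, and $A^{(2)}_{\mathrm{OO}}(4n;x;a,b,c)=c^{-2n}\sigma(a)^{-2n^2+n}F_{\mathrm{OD}}(n;x;a)\operatorname{Pf}M_{\mathrm{OO}}(n;x;a,b,c)$, where $\operatorname{Pf}$ denotes the Pfaffian. *)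

(* Defs.v *)
From HB Require Import structures.
From mathcomp Require Import all_boot all_order all_algebra all_fingroup.
From mathcomp Require Import mpoly.

Set Implicit Arguments.
Unset Strict Implicit.
Unset Printing Implicit Defensive.

Import GRing.Theory.

Local Open Scope ring_scope.

Section Pfaffian.

Variables (R : comNzRingType) (n : nat).

Definition even_idx (i : 'I_n) : 'I_n.*2 :=
  Ordinal (etrans (ltn_double i n) (ltn_ord i)).

Definition odd_idx (i : 'I_n) : 'I_n.*2 :=
  Ordinal (etrans (ltn_Sdouble i n) (ltn_ord i)).

(* The perfect matching {s 0, s 1}, {s 2, s 3}, ... of the 2n indices
   determines s once each pair is written in increasing order and the pairs
   are ordered by their smaller elements. *)
Definition is_matching (s : 'S_n.*2) : bool :=
  [forall i : 'I_n, (s (even_idx i) < s (odd_idx i))%N] &&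
  [forall i : 'I_n, forall j : 'I_n,
     (i < j)%N ==> (s (even_idx i) < s (even_idx j))%N].

(* Only entries strictly above the diagonal are used; the matrix is meant to
   be skew-symmetric. *)
Definition Pf (A : 'M[R]_n.*2) : R :=
  \sum_(s : 'S_n.*2 | is_matching s)
     (-1) ^+ s * \prod_(i < n) A (s (even_idx i)) (s (odd_idx i)).

End Pfaffian.

Section OffDiagonallySymmetric.

Variable F : fieldType.

Definition sigma (t : F) : F := t - t^-1.

Definition M_OO n (x : 'I_n.*2 -> F) (a b c : F) : 'M[F]_n.*2 :=
  \matrix_(i, j) (sigma (x j / x i) *
    (c ^+ 2 / sigma (a * x i * x j) + b ^+ 2 / sigma (a / (x i * x j)))).

Definition F_OD n (x : 'I_n.*2 -> F) (a : F) : F :=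
  (\prod_(i < n.*2) \prod_(j < n.*2 | (i < j)%N)
     (sigma (a * x i * x j) * sigma (a / (x i * x j)))) /
  (\prod_(i < n.*2) \prod_(j < n.*2 | (i < j)%N) sigma (x j / x i)).

(* A^(2)_OO(4n; x; a, b, c): the index 4n is encoded by n. *)
Definition A2_OO n (x : 'I_n.*2 -> F) (a b c : F) : F :=
  c ^ (- (2 * n%:Z)) * sigma a ^ (- (2 * n%:Z ^+ 2) + n%:Z) *
  F_OD x a * Pf (M_OO x a b c).

End OffDiagonallySymmetric.

Section RationalFunctions.

Variables (K : fieldType) (m : nat).

Definition ratfun : fieldType := {fraction {mpoly K[m]}}.

Definition ratC (k : K) : ratfun := FracField.tofrac (k%:MP_[m]).

Definition ratX (i : 'I_m) : ratfun := FracField.tofrac ('X_i : {mpoly K[m]}).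

End RationalFunctions.

(* Main.v *)
(* With X = x^2 and a = zeta_4, both sigma (a x_i x_j) and sigma (a / (x_i x_j))
   equal zeta_4 (1 + X_i X_j) / (x_i x_j), and the Cayley transform
   u = (1 + zeta_4 X) / (1 - zeta_4 X) turns the (i, j) entry of M_OO into
   2 b^2 (u_i - u_j) / (u_i + u_j), whose Pfaffian is Schur's.  Schur's formula
   follows by induction on n from the expansion along the first row, which
   reduces it to an interpolation identity in an odd number of variables. *)

Require Import Defs.
From mathcomp Require Import all_boot all_order all_algebra all_fingroup.
From mathcomp Require Import mpoly ring zify.

Set Implicit Arguments.
Unset Strict Implicit.
Unset Printing Implicit Defensive.

Import GRing.Theory.

Local Open Scope ring_scope.

(** * Expansion of a Pfaffian along its first row *)

Section PfaffianExpansion.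

Lemma lift_perm_inj n (i j : 'I_n.+1) : injective (lift_perm i j).
Proof.
move=> s t est; apply/permP=> k; apply: (@lift_inj _ j).
by rewrite -!(lift_perm_lift i) est.
Qed.

Lemma lift_perm_onto n (s : 'S_n.+1) i : exists t, s = lift_perm i (s i) t.
Proof.
(* The default [k] is never reached, because [s (lift i k)] differs from [s i]. *)
pose f k := odflt k (unlift (s i) (s (lift i k))).
have fE k : lift (s i) (f k) = s (lift i k).
  rewrite /f; have [|k' -> ->] := @unlift_some _ (s i) (s (lift i k)); last by [].
  by rewrite (inj_eq perm_inj) neq_lift.
have f_inj : injective f.
  move=> k l fkl; apply: (@lift_inj _ i); apply: (@perm_inj _ s).
  by rewrite -!fE fkl.
exists (perm f_inj); apply/permP=> k; case: (unliftP i k) => [k'|] ->.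
  by rewrite lift_perm_lift permE fE.
by rewrite lift_perm_id.
Qed.

Lemma ltn_lift n (h : 'I_n.+1) (i j : 'I_n) : (lift h i < lift h j)%N = (i < j)%N.
Proof. by rewrite /= !ltnNge leq_bump2. Qed.

(* The matching pairing 0 with the index [lift ord0 jt.1], the other indices
   being paired as prescribed by jt.2. *)
Definition cons_matching n (jt : 'I_n.*2.+1 * 'S_n.*2) : 'S_n.+1.*2 :=
  lift_perm (n := n.*2.+1) ord0 ord0 (lift_perm ord0 jt.1 jt.2).

Lemma cons_matching_inj n : injective (@cons_matching n).
Proof.
move=> [j t] [j' t'] /lift_perm_inj /= e.
have ej : j = j' by rewrite -(lift_perm_id ord0 j t) e lift_perm_id.
by rewrite ej in e *; rewrite (lift_perm_inj e).
Qed.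

Lemma even_idx0 n : even_idx (ord0 : 'I_n.+1) = (ord0 : 'I_n.*2.+2).
Proof. exact: val_inj. Qed.

Lemma odd_idx0 n : odd_idx (ord0 : 'I_n.+1) = lift ord0 (ord0 : 'I_n.*2.+1).
Proof. exact: val_inj. Qed.

Lemma even_idxS n (i : 'I_n) :
  even_idx (lift ord0 i) = lift (ord0 : 'I_n.*2.+2) (lift ord0 (even_idx i)).
Proof. exact: val_inj. Qed.

Lemma odd_idxS n (i : 'I_n) :
  odd_idx (lift ord0 i) = lift (ord0 : 'I_n.*2.+2) (lift ord0 (odd_idx i)).
Proof. exact: val_inj. Qed.

Definition idxE := (even_idx0, odd_idx0, even_idxS, odd_idxS).

Lemma cons_matching0 n j (t : 'S_n.*2) :
  cons_matching (j, t) (ord0 : 'I_n.*2.+2) = (ord0 : 'I_n.*2.+2).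
Proof. exact: lift_perm_id. Qed.

Lemma cons_matching1 n j (t : 'S_n.*2) :
  cons_matching (j, t) (lift ord0 (ord0 : 'I_n.*2.+1)) = lift (ord0 : 'I_n.*2.+2) j.
Proof. by rewrite /cons_matching lift_perm_lift lift_perm_id. Qed.

Lemma cons_matchingS n j (t : 'S_n.*2) k :
  cons_matching (j, t) (lift (ord0 : 'I_n.*2.+2) (lift ord0 k)) =
  lift (ord0 : 'I_n.*2.+2) (lift j (t k)).
Proof. by rewrite /cons_matching !lift_perm_lift. Qed.

Definition cons_matchingE := (cons_matching0, cons_matching1, cons_matchingS).

(** Lifting preserves order, and the new pair comes first and starts with the smallest index 0, so
    it adds no condition on [t]. *)
Lemma is_matching_cons n j (t : 'S_n.*2) :
  is_matching (cons_matching (j, t)) = is_matching t.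
Proof.
apply/andP/andP=> -[/forallP evodd /forallP mono]; split; apply/forallP => i.
- by have := evodd (lift ord0 i); rewrite !idxE !cons_matchingE !ltn_lift.
- apply/forallP=> k; have /forallP/(_ (lift ord0 k)) := mono (lift ord0 i).
  by rewrite !idxE !cons_matchingE !ltn_lift.
- case: (unliftP ord0 i) => [i'|] ->; rewrite !idxE !cons_matchingE ?ltn_lift //.
- apply/forallP=> k; case: (unliftP ord0 i) => [i'|] ->.
    case: (unliftP ord0 k) => [k'|] ->; rewrite ?ltn0 //.
    rewrite !idxE !cons_matchingE !ltn_lift.
    by have /forallP/(_ k') := mono i'.
  case: (unliftP ord0 k) => [k'|] ->; rewrite ?ltnn //.
  by rewrite !idxE !cons_matchingE; apply/implyP.
Qed.

(** As the smallest index, 0 is the smaller element of its pair, hence the image of an even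
    position. The smaller elements increase from pair to pair, so this position is the first one. *)
Lemma matching_fix0 n (s : 'S_n.+1.*2) :
  is_matching s -> s (ord0 : 'I_n.*2.+2) = (ord0 : 'I_n.*2.+2).
Proof.
case/andP=> /forallP evodd /forallP mono.
have ev0 (i : 'I_n.+1) : s (even_idx i) = (ord0 : 'I_n.*2.+2) -> i = ord0.
  case: (unliftP ord0 i) => [i' ->|-> //] e.
  have /forallP/(_ (lift ord0 i')) := mono ord0.
  by rewrite e.
have od0 (i : 'I_n.+1) : s (odd_idx i) <> (ord0 : 'I_n.*2.+2).
  by move=> e; have := evodd i; rewrite e.
pose k := (s^-1)%g (ord0 : 'I_n.*2.+2).
have sk : s k = (ord0 : 'I_n.*2.+2) by rewrite permKV.
have lt_half : (k./2 < n.+1)%N by rewrite ltn_half_double.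
have := odd_double_half k; case: (odd k) => [] /= ek.
  by case: (od0 (Ordinal lt_half)); rewrite -[RHS]sk; congr (s _); apply: val_inj.
rewrite -[RHS]sk; congr (s _).
have ek' : even_idx (Ordinal lt_half) = k by apply: val_inj.
by rewrite -ek' (ev0 (Ordinal lt_half)) ?ek' // even_idx0.
Qed.

Lemma is_matchingP n (s : 'S_n.+1.*2) :
  is_matching s -> exists jt, s = cons_matching jt.
Proof.
move=> /matching_fix0 s0.
have [s' es] := @lift_perm_onto n.*2.+1 s ord0; rewrite s0 in es.
have [t et] := @lift_perm_onto n.*2 s' ord0.
by exists (s' ord0, t); rewrite /cons_matching -et.
Qed.

Lemma PfZ (R : comNzRingType) n (c : R) (A : 'M[R]_n.*2) : Pf (c *: A) = c ^+ n * Pf A.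
Proof.
rewrite /Pf mulr_sumr; apply: eq_bigr => s _; rewrite mulrCA; congr (_ * _).
rewrite -[X in c ^+ X]card_ord -prodr_const -big_split.
by apply: eq_bigr => i _; rewrite mxE.
Qed.

(** Matchings are classified by the partner [lift ord0 j] of 0 together with a matching of the
    remaining indices. Two uses of [odd_lift_perm] show that the sign of [cons_matching (j, t)] is
    [(-1) ^+ j] times that of [t]. *)
Lemma Pf_expand (R : comNzRingType) n (A : 'M[R]_n.+1.*2) :
  Pf A = \sum_(j < n.*2.+1) (-1) ^+ j *
    A (ord0 : 'I_n.*2.+2) (lift (ord0 : 'I_n.*2.+2) j) *
    Pf (\matrix_(k < n.*2, l < n.*2)
      A (lift (ord0 : 'I_n.*2.+2) (lift j k)) (lift (ord0 : 'I_n.*2.+2) (lift j l))).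
Proof.
pose M := [set jt : 'I_n.*2.+1 * 'S_n.*2 | is_matching jt.2].
rewrite /Pf (eq_bigl (mem (@cons_matching n @: M))); last first.
  move=> s; apply/idP/imsetP => [ms|[[j t]]].
    have [[j t] es] := is_matchingP ms; exists (j, t) => //.
    by move: ms; rewrite es is_matching_cons inE.
  by rewrite inE => mt ->; rewrite is_matching_cons.
rewrite big_imset /=; last by move=> ? ? _ _; apply: cons_matching_inj.
under [RHS]eq_bigr do rewrite mulr_sumr.
rewrite pair_big_dep /=; apply: eq_big => [[j t]|[j t] _]; first by rewrite inE.
rewrite big_ord_recl !idxE !cons_matchingE !odd_lift_perm /=.
rewrite !signr_addb signr_odd.
rewrite mulrACA !mulrA; congr (_ * _ * _).
by apply: eq_bigr => i _; rewrite !idxE !cons_matchingE mxE.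
Qed.

End PfaffianExpansion.

(** * Products over pairs of indices *)

Section PairProducts.

Lemma prod_pairs_recl (R : pzSemiRingType) m (f : 'I_m.+1 -> 'I_m.+1 -> R) :
  \prod_(i < m.+1) \prod_(j < m.+1 | (i < j)%N) f i j =
  \prod_(j < m) f ord0 (lift ord0 j) *
  \prod_(i < m) \prod_(j < m | (i < j)%N) f (lift ord0 i) (lift ord0 j).
Proof.
rewrite big_ord_recl; congr (_ * _).
  by rewrite big_mkcond big_ord_recl /= mul1r.
by apply: eq_bigr => i _; rewrite big_mkcond big_ord_recl /= mul1r -big_mkcond.
Qed.

(** Moving [h] to the front reverses exactly the [h] pairs whose larger index is [h], and each
    reversal costs a sign. *)
Lemma prod_pairs_lift (R : comPzRingType) m (f : 'I_m.+1 -> 'I_m.+1 -> R)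
    (h : 'I_m.+1) :
  (forall i j, f i j = - f j i) ->
  \prod_(i < m.+1) \prod_(j < m.+1 | (i < j)%N) f i j =
  (-1) ^+ h * \prod_(k < m) f h (lift h k) *
  \prod_(i < m) \prod_(j < m | (i < j)%N) f (lift h i) (lift h j).
Proof.
move=> fN; rewrite (bigD1_ord h) //= mulrC.
under eq_bigr => i _.
  rewrite big_mkcond (bigD1_ord h) //=.
  under eq_bigr do rewrite ltnNge leq_bump2 -ltnNge.
  rewrite -big_mkcond; over.
rewrite big_split /= mulrAC; congr (_ * _).
rewrite [X in _ * X]big_mkcond (bigD1_ord h) //= ltnn mul1r -big_split /=.
have -> : (-1) ^+ h = \prod_(k < m) (if (k < h)%N then -1 else 1) :> R.
  rewrite -big_mkcond prodr_const; congr (_ ^+ _).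
  rewrite -[LHS]card_ord; apply/esym.
  have le_hm : (h <= m)%N by rewrite -ltnS.
  by rewrite -sum1_card (big_ord_narrow le_hm) sum1_card.
rewrite -big_split /=; apply: eq_bigr => k _.
rewrite /bump; case: (leqP h k) => [le_hk|lt_kh]; rewrite ?add1n ?add0n.
  have -> : (k.+1 < h)%N = false by lia.
  by rewrite ltnS le_hk.
have -> : (h < k)%N = false by lia.
by rewrite lt_kh mulr1 mulN1r -fN.
Qed.

Lemma prod_pairs_const (R : pzSemiRingType) m (c : R) :
  \prod_(i < m) \prod_(j < m | (i < j)%N) c = c ^+ 'C(m, 2).
Proof.
elim: m => [|m IHm]; first by rewrite big_ord0.
by rewrite prod_pairs_recl IHm prodr_const card_ord -exprD binS bin1 addnC.
Qed.

(** Every index lies in [m.-1] pairs. *)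
Lemma prod_pairs_mul (R : comPzSemiRingType) m (f : 'I_m -> R) :
  \prod_(i < m) \prod_(j < m | (i < j)%N) (f i * f j) =
  \prod_(i < m) f i ^+ m.-1.
Proof.
elim: m f => [|m IHm] f; first by rewrite !big_ord0.
rewrite prod_pairs_recl IHm big_split big_ord_recl prodr_const card_ord /= -mulrA.
congr (_ * _); rewrite -big_split; apply: eq_bigr => i _ /=.
by move: (f _) => y; case: m i {IHm f} => [[]|m] //= _; rewrite exprS.
Qed.

End PairProducts.

(** * Schur's Pfaffian *)

Section SchurPfaffian.

Variable F : fieldType.

(** Both products are monic of degree [m], so their leading terms cancel. *)
Lemma size_prod_XsubC_sub m (v w : 'I_m -> F) :
  (size (\prod_(k < m) ('X - (v k)%:P) - \prod_(k < m) ('X - (w k)%:P))%R <= m)%N.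
Proof.
apply/leq_sizeP => j le_mj; rewrite coefB.
have szP (z : 'I_m -> F) : size (\prod_(k < m) ('X - (z k)%:P)) = m.+1.
  by rewrite size_prod_XsubC /index_enum -enumT size_enum_ord.
case: (ltngtP m j) le_mj => // [lt_mj|<-] _.
  by rewrite !nth_default ?szP ?subrr.
have lcP (z : 'I_m -> F) : (\prod_(k < m) ('X - (z k)%:P))`_m = 1.
  have /monicP := monic_prod_XsubC (index_enum 'I_m) xpredT z.
  by rewrite lead_coefE szP.
by rewrite !lcP subrr.
Qed.

(** This is the first-row expansion of Schur's Pfaffian after clearing denominators, with [t] the
    first variable and [u] the others. As polynomials in [t] the two sides agree at every [- u i],
    hence differ by a multiple of the product of the [t + u k]; the value at 0 shows that this
    multiple is zero. *)
Lemma odd_interpolation m (u : 'I_m.+1 -> F) (t : F) :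
    ~~ odd m -> 2%:R != 0 :> F -> injective u -> (forall i, u i != 0) ->
  \sum_(j < m.+1) (t - u j) * (\prod_(k < m) (t + u (lift j k))) *
     \prod_(k < m) ((u j + u (lift j k)) / (u j - u (lift j k))) =
  \prod_(k < m.+1) (t - u k).
Proof.
move=> even_m two_neq0 u_inj u_neq0.
pose d j := \prod_(k < m) ((u j + u (lift j k)) / (u j - u (lift j k))).
pose S := \sum_j d j.
(* The roots of the j-th summand, seen as a polynomial in [t]. *)
pose v j k := if k == j then u j else - u k.
pose P (z : 'I_m.+1 -> F) := \prod_(k < m.+1) ('X - (z k)%:P).
have PE z x : (P z).[x] = \prod_k (x - z k).
  by rewrite horner_prod; apply: eq_bigr => k _; rewrite hornerXsubC.
have PvE j x : (P (v j)).[x] = (x - u j) * \prod_(k < m) (x + u (lift j k)).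
  rewrite PE (bigD1_ord j) //= /v eqxx; congr (_ * _).
  by apply: eq_bigr => k _; rewrite eq_sym (negPf (neq_lift _ _)) opprK.
pose D := \sum_j d j *: P (v j) - P u.
(* Q is a combination of differences of monic polynomials of degree m + 1, so
   it has degree at most m, while it vanishes at the m + 1 points - u_i. *)
pose Q := D - (S - 1) *: P (fun k => - u k).
have DE x : D.[x] = \sum_j d j * ((x - u j) * \prod_(k < m) (x + u (lift j k)))
                     - \prod_k (x - u k).
  rewrite hornerD hornerN PE horner_sum; congr (_ - _).
  by apply: eq_bigr => j _; rewrite hornerZ PvE.
have QE x : Q.[x] = D.[x] - (S - 1) * \prod_k (x + u k).
  rewrite hornerD hornerN hornerZ PE; congr (_ - _ * _).
  by apply: eq_bigr => k _; rewrite opprK.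
have Q0 : Q = 0.
  apply: (@roots_geq_poly_eq0 _ _ (codom (fun k => - u k))).
  (* At [- u i] every summand with [j != i] contains the factor [- u i + u i]. The i-th summand
     cancels against [P u]: the weight [d i] turns each [- u i + u k] into [- u i - u k]. *)
  - apply/allP => _ /codomP[i ->]; rewrite rootE QE DE (bigD1 i) //=.
    rewrite [X in _ + X - _ - _]big1 ?addr0 => [|j ne_ji]; last first.
      case: (unliftP j i) ne_ji => [k ->|->]; last by rewrite eqxx.
      by move=> _; rewrite (bigD1 k) //= addNr mul0r !mulr0.
    rewrite !(bigD1_ord i (P := xpredT)) //= addNr mul0r mulr0 subr0.
    rewrite mulrCA -mulrBr; apply/eqP.
    suff -> : d i * \prod_(k < m) (- u i + u (lift i k)) =
              \prod_(k < m) (- u i - u (lift i k)) by rewrite subrr mulr0.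
    rewrite -big_split; apply: eq_bigr => k _ /=.
    have: u i - u (lift i k) != 0.
      by rewrite subr_eq0 (inj_eq u_inj) neq_lift.
    by move=> ne; field.
  - by apply/injectiveP => i j /oppr_inj /u_inj.
  rewrite size_codom card_ord.
  have -> : Q = \sum_j d j *: (P (v j) - P (fun k => - u k))
                - (P u - P (fun k => - u k)).
    rewrite (eq_bigr (fun j => d j *: P (v j) - d j *: P (fun k => - u k))).
      rewrite sumrB -scaler_suml -/S /Q /D scalerBl scale1r.
      by rewrite !opprB -!addrA; congr (_ + _); rewrite addrCA [RHS]addrCA [- _ - _]addrC.
    by move=> j _; rewrite scalerBr.
  rewrite (leq_trans (size_polyD _ _)) // geq_max size_polyN size_prod_XsubC_sub.
  rewrite andbT (leq_trans (size_sum _ _ _)) //; apply/bigmax_leqP => j _.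
  by rewrite (leq_trans (size_scale_leq _ _)) // size_prod_XsubC_sub.
(* At 0, Q = 0 says 2 (S - 1) = 0 up to the nonzero factor prod_k u_k, the
   parity of the number of variables entering through the sign of P u. *)
have S1 : S - 1 = 0.
  have := congr1 (fun p => p.[0]) Q0.
  rewrite horner0 QE DE.
  pose U := \prod_k u k; have U0 : U != 0 by apply/prodf_neq0.
  rewrite (eq_bigr (fun j => d j * - U)) => [|j _]; last first.
    rewrite /U (bigD1_ord j (P := xpredT)) //= sub0r mulNr.
    by under eq_bigr do rewrite add0r.
  rewrite -mulr_suml -/S.
  under [X in _ - X - _]eq_bigr do rewrite sub0r.
  rewrite prodrN card_ord -signr_odd /= even_m expr1.
  under [X in _ - _ * X]eq_bigr do rewrite add0r.
  rewrite -/U => e; have : 2%:R * U * (S - 1) = 0 by rewrite -[RHS]oppr0 -e; ring.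
  by move/eqP; rewrite !mulf_eq0 (negPf two_neq0) (negPf U0) => /eqP.
apply/eqP; rewrite -subr_eq0; apply/eqP.
have := QE t; rewrite Q0 horner0 S1 mul0r subr0 DE => e; rewrite [RHS]e; congr (_ - _).
by apply: eq_bigr => j _; rewrite mulrC.
Qed.

Lemma Schur_Pfaffian n (u : 'I_n.*2 -> F) :
    2%:R != 0 :> F -> injective u -> (forall i, u i != 0) ->
    (forall i j, i != j -> u i + u j != 0) ->
  Pf (\matrix_(i, j) ((u i - u j) / (u i + u j))) =
  \prod_(i < n.*2) \prod_(j < n.*2 | (i < j)%N) ((u i - u j) / (u i + u j)).
Proof.
move=> two_neq0; elim: n u => [|n IHn] u u_inj u_neq0 u_add.
  rewrite [RHS]big_ord0 /Pf (big_pred1 1%g) => [|s].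
    by rewrite odd_perm1 big_ord0 mulr1.
  have -> : s = 1%g by apply/permP => -[].
  rewrite /is_matching /= eqxx.
  by apply/andP; split; apply/forallP => -[].
pose g i j := (u i - u j) / (u i + u j).
have gN i j : g i j = - g j i by rewrite /g -mulNr opprB [u j + _]addrC.
pose w (k : 'I_n.*2.+1) : F := u (lift (ord0 : 'I_n.*2.+2) k).
pose t := u (ord0 : 'I_n.*2.+2).
have w_inj : injective w by move=> i j /u_inj /lift_inj.
have wD i j : i != j -> w i + w j != 0.
  by move=> ne; apply: u_add; rewrite (inj_eq lift_inj).
have tD i : t + w i != 0 by apply: u_add; rewrite neq_lift.
rewrite Pf_expand [RHS](@prod_pairs_recl _ n.*2.+1 g).
set W := (X in _ = _ * X).
have := odd_interpolation t _ two_neq0 w_inj (fun i => u_neq0 _).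
rewrite odd_double => /(_ isT) interp.
(* Replacing the numerator of the first-row product by the interpolation sum turns both sides into
   sums over [j], compared term by term. *)
rewrite prodf_div -interp mulr_suml mulr_suml; apply: eq_bigr => j _.
rewrite mxE (_ : Pf _ = \prod_(i < n.*2) \prod_(k < n.*2 | (i < k)%N)
    ((w (lift j i) - w (lift j k)) / (w (lift j i) + w (lift j k)))); last first.
  rewrite -(IHn (fun i => w (lift j i))).
  - by congr Pf; apply/matrixP => i k; rewrite !mxE.
  - by move=> i k /w_inj /lift_inj.
  - by move=> i; apply: u_neq0.
  - by move=> i k ne; apply: wD; rewrite (inj_eq lift_inj).
(* Bringing [j] to the front of the remaining product yields the sign of the expansion and a factor
   [G] inverse to the interpolation weight [H]. *)
rewrite /W (prod_pairs_lift j) => [|i k]; last exact: gN.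
set Q := \prod_(i < n.*2) _; rewrite -/Q.
rewrite (bigD1_ord j (P := xpredT)) //= invfM.
set T := \prod_(k < n.*2) (t + _).
set G := \prod_(k < n.*2) g _ _.
set H := \prod_(k < n.*2) (_ / _).
have T0 : T != 0 by apply/prodf_neq0.
have HG : H * G = 1.
  rewrite -big_split big1 //= => k _; rewrite /g -/(w j) -/(w (lift j k)).
  have ? : w j + w (lift j k) != 0 by rewrite wD ?neq_lift.
  have ? : w j - w (lift j k) != 0 by rewrite subr_eq0 (inj_eq w_inj) neq_lift.
  by field; apply/andP.
rewrite -[LHS]mul1r -HG -/t -/(w j); have := tD j => tj.
by field; apply/andP.
Qed.

End SchurPfaffian.

(** * Nonvanishing in the field of rational functions *)

Section RationalFunctionsFacts.

Variables (K : fieldType) (m : nat).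

(** Reduces the nonvanishing of each denominator to an evaluation at one well-chosen point. *)
Lemma tofrac_meval_neq0 (v : 'I_m -> K) (p : {mpoly K[m]}) :
  p.@[v] != 0 -> FracField.tofrac p != 0 :> ratfun K m.
Proof.
by rewrite tofrac_eq0; apply: contraNneq => ->; rewrite meval0.
Qed.

Lemma ratX_neq0 (i : 'I_m) : ratX K i != 0.
Proof.
by apply: (@tofrac_meval_neq0 (fun=> 1)); rewrite mevalXU oner_neq0.
Qed.

Lemma ratX_sqr_affine_neq0 (c : K) (i : 'I_m) : 1 + ratC m c * ratX K i ^+ 2 != 0.
Proof.
rewrite /ratC /ratX -tofrac1 -tofracXn -tofracM -tofracD.
apply: (@tofrac_meval_neq0 (fun=> 0)).
by rewrite mevalD meval1 mevalM rmorphXn /= mevalXU expr0n mulr0 addr0 oner_neq0.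
Qed.

Lemma ratX_sqr_mul_neq0 (i j : 'I_m) : 1 + ratX K i ^+ 2 * ratX K j ^+ 2 != 0.
Proof.
rewrite /ratX -tofrac1 -!tofracXn -tofracM -tofracD.
apply: (@tofrac_meval_neq0 (fun=> 0)).
by rewrite mevalD meval1 mevalM !rmorphXn /= !mevalXU expr0n mulr0 addr0 oner_neq0.
Qed.

Lemma ratX_sqr_sub_neq0 (i j : 'I_m) : i != j -> ratX K i ^+ 2 - ratX K j ^+ 2 != 0.
Proof.
move=> ne_ij; rewrite /ratX -!tofracXn -tofracB.
(* At the i-th unit vector the difference of squares is 1 - 0. *)
apply: (@tofrac_meval_neq0 (fun k => (k == i)%:R)).
rewrite mevalB !rmorphXn /= !mevalXU eqxx [j == i]eq_sym (negPf ne_ij).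
by rewrite expr1n expr0n subr0 oner_neq0.
Qed.

End RationalFunctionsFacts.

(** * The specialization at a square root of -1, with equal [b] and [c], over a field *)

Section OffDiagonalSpecialization.

Variables (F : fieldType) (z : F).
Hypotheses (two_neq0 : 2%:R != 0 :> F) (zz : z ^+ 2 = -1).

Let z_neq0 : z != 0.
Proof. by rewrite -sqrf_eq0 zz oppr_eq0 oner_eq0. Qed.

(** The denominator is written with [+ - z] so that it and the numerator both have the shape
    [1 + c * x ^+ 2] treated by [ratX_sqr_affine_neq0]. *)
Definition cayley (x : F) : F := (1 + z * x ^+ 2) / (1 + - z * x ^+ 2).

Lemma cayleyB x y : 1 + - z * x ^+ 2 != 0 -> 1 + - z * y ^+ 2 != 0 ->
  cayley x - cayley y = 2%:R * z * (x ^+ 2 - y ^+ 2) /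
    ((1 + - z * x ^+ 2) * (1 + - z * y ^+ 2)).
Proof. by move=> nx ny; rewrite /cayley; field; rewrite nx ny. Qed.

Lemma cayleyD x y : 1 + - z * x ^+ 2 != 0 -> 1 + - z * y ^+ 2 != 0 ->
  cayley x + cayley y = 2%:R * (1 + x ^+ 2 * y ^+ 2) /
    ((1 + - z * x ^+ 2) * (1 + - z * y ^+ 2)).
Proof.
move=> nx ny; rewrite /cayley.
(* The numerator of the sum is 2 - 2 z^2 x^2 y^2; restoring z^2 makes the identity hold for a formal
   [z], as [field] requires. *)
have -> : x ^+ 2 * y ^+ 2 = - (z ^+ 2 * (x ^+ 2 * y ^+ 2)).
  by rewrite zz mulN1r opprK.
by field; rewrite nx ny.
Qed.

(** Since [z^-1 = - z], the difference in [sigma] becomes a sum, invariant under inverting [y]. *)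
Lemma sigma_mul_sqrtN1 y : sigma (z * y) = z * (y + y^-1).
Proof.
have zV : z^-1 = - z by apply: (mulfI z_neq0); rewrite mulfV // mulrN -expr2 zz opprK.
by rewrite /sigma invfM zV mulNr opprK mulrDr.
Qed.

Variables (n : nat) (x : 'I_n.*2 -> F) (b : F).
Hypotheses (b_neq0 : b != 0) (x_neq0 : forall i, x i != 0)
  (x_affine_neq0 : forall i, 1 + z * x i ^+ 2 != 0)
  (x_affine_neq0' : forall i, 1 + - z * x i ^+ 2 != 0)
  (x_mul_neq0 : forall i j, 1 + x i ^+ 2 * x j ^+ 2 != 0)
  (x_sub_neq0 : forall i j, i != j -> x i ^+ 2 - x j ^+ 2 != 0).

Let u i := cayley (x i).
(** This is y + 1/y for y = x_i x_j. *)
Let q i j := (1 + x i ^+ 2 * x j ^+ 2) / (x i * x j).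

Lemma sigma_sqrtN1 i j :
  (sigma (z * x i * x j) = z * q i j) * (sigma (z / (x i * x j)) = z * q i j).
Proof.
rewrite -mulrA !sigma_mul_sqrtN1 invrK /q.
by split; field; rewrite !x_neq0.
Qed.

Lemma sigma_ratio i j : sigma (x j / x i) = (x j ^+ 2 - x i ^+ 2) / (x i * x j).
Proof. by rewrite /sigma; field; rewrite !x_neq0. Qed.

Lemma cayley_ratio i j :
  (u i - u j) / (u i + u j) = z * (x i ^+ 2 - x j ^+ 2) / (1 + x i ^+ 2 * x j ^+ 2).
Proof.
rewrite /u cayleyB // cayleyD //.
by field; rewrite exprMn x_mul_neq0 two_neq0 !x_affine_neq0'.
Qed.

Lemma M_OO_sqrtN1 : M_OO x z b b =
  (2%:R * b ^+ 2) *: (\matrix_(i, j) ((u i - u j) / (u i + u j))).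
Proof.
apply/matrixP => i j; rewrite !mxE cayley_ratio sigma_ratio !sigma_sqrtN1 /q.
(* The left side carries [z] in the denominator and the opposite difference of squares; this
   relation reconciles the two. *)
have zV : z = - z^-1 by apply: (mulIf z_neq0); rewrite mulNr mulVf // -expr2.
rewrite [in RHS]zV.
by field; rewrite ?exprMn x_mul_neq0 z_neq0 !x_neq0.
Qed.

(** Apart from the scalar, both factors are products over pairs: [F_OD] contributes (z q)^2 /
    sigma(x_j/x_i), and Schur's formula contributes sigma(x_j/x_i) / (z q). *)
Lemma F_OD_Pf : F_OD x z * Pf (M_OO x z b b) =
  (2%:R * b ^+ 2) ^+ n *
  \prod_(i < n.*2) \prod_(j < n.*2 | (i < j)%N) (z * q i j).
Proof.
rewrite M_OO_sqrtN1 PfZ Schur_Pfaffian //; first last.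
- by move=> i j _; rewrite /u cayleyD // !mulf_neq0 ?invr_neq0 ?mulf_neq0.
- by move=> i; rewrite /u mulf_neq0 ?invr_neq0.
- move=> i j; apply: contra_eq => ne_ij; rewrite -subr_eq0 /u cayleyB //.
  by rewrite !mulf_neq0 ?invr_neq0 ?mulf_neq0 ?x_sub_neq0.
rewrite mulrCA; congr (_ * _); rewrite /F_OD -prodf_div -big_split.
apply: eq_bigr => i _; rewrite -prodf_div -big_split; apply: eq_bigr => j lt_ij.
rewrite /= !sigma_sqrtN1 sigma_ratio cayley_ratio /q.
have ne_ji : x j ^+ 2 - x i ^+ 2 != 0 by rewrite x_sub_neq0 // neq_ltn lt_ij orbT.
rewrite -[z in z * (x i ^+ 2 - _)]opprK.
have -> : - z = z^-1 by apply: (mulfI z_neq0); rewrite mulfV // mulrN -expr2 zz opprK.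
by field; rewrite ?exprMn ne_ji z_neq0 x_mul_neq0 !x_neq0.
Qed.

Lemma prod_pairs_q : \prod_(i < n.*2) \prod_(j < n.*2 | (i < j)%N) (z * q i j) =
  z ^+ 'C(n.*2, 2) * (\prod_(i < n.*2) (x i)^-1 ^+ n.*2.-1) *
  \prod_(i < n.*2) \prod_(j < n.*2 | (i < j)%N) (1 + x i ^+ 2 * x j ^+ 2).
Proof.
rewrite -prod_pairs_const -prod_pairs_mul -!big_split.
apply: eq_bigr => i _; rewrite -!big_split; apply: eq_bigr => j _ /=.
by rewrite /q invfM -mulrA [_ * (_ / _)]mulrC mulrA.
Qed.

(** Here [sigma z] is 2z. The exponent -2n^2+n of this factor is the opposite of the number of
    pairs, so the powers of [z] cancel, as do those of [b]; the powers of 2 from [sigma z] and from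
    the Pfaffian combine. *)
Lemma A2_OO_sqrtN1 : (0 < n)%N -> A2_OO x z b b =
  2%:R ^ (- (2 * n%:Z ^+ 2) + 2 * n%:Z) *
  (\prod_(i < n.*2) x i ^ (- (2 * n%:Z) + 1)) *
  (\prod_(i < n.*2) \prod_(j < n.*2 | (i < j)%N) (1 + x i ^+ 2 * x j ^+ 2)).
Proof.
move=> n_gt0; rewrite /A2_OO -mulrA F_OD_Pf prod_pairs_q.
set e := - _ + n%:Z; set e' := _ + 2 * _; rewrite !mulrA.
congr (_ * _).
(* As n is positive, the truncated [n.*2.-1] is 2n - 1. *)
have -> : \prod_(i < n.*2) x i ^ (- (2 * n%:Z) + 1) =
          \prod_(i < n.*2) (x i)^-1 ^+ n.*2.-1.
  apply: eq_bigr => i _; rewrite exprVn exprnN; congr (_ ^ _); lia.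
congr (_ * _).
have -> : sigma z = 2%:R * z.
  by rewrite -[X in sigma X]mulr1 sigma_mul_sqrtN1 invr1 mulrC.
have C2 : 'C(n.*2, 2)%:Z = - e.
  rewrite bin2 (_ : n.*2 * n.*2.-1 = (n * n.*2.-1).*2)%N; last by lia.
  by rewrite doubleK /e; nia.
have zE : z ^ e * z ^ (- e) = 1 by rewrite -expfzDr // subrr expr0z.
have bE : b ^ (- (2 * n%:Z)) * b ^ (2 * n)%N = 1.
  by rewrite -expfzDr // PoszM addNr expr0z.
have tE : 2%:R ^ e * 2%:R ^ n%:Z = 2%:R ^ e' :> F.
  by rewrite -expfzDr //; congr (_ ^ _); rewrite /e /e'; ring.
rewrite -[2%:R * b * b]mulrA -expr2 exprMn -exprM !exprnP C2 expfzMl.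
by rewrite -tE -[RHS]mulr1 -zE -[RHS]mulr1 -bE; ring.
Qed.

End OffDiagonalSpecialization.

(** * The identity for indeterminates *)

Theorem theorem2p4 (K : fieldType) (charK0 : [pchar K] =i pred0)
    (zeta4 : K) (zeta4_sqrtN1 : zeta4 ^+ 2 = -1)
    (n : nat) (n_ge1 : (1 <= n)%N) (b : K) (b_neq0 : b != 0) :
  let x : 'I_n.*2 -> ratfun K n.*2 := @ratX K n.*2 in
  A2_OO x (ratC n.*2 zeta4) (ratC n.*2 b) (ratC n.*2 b) =
    2%:R ^ (- (2 * n%:Z ^+ 2) + 2 * n%:Z) *
    (\prod_(i < n.*2) x i ^ (- (2 * n%:Z) + 1)) *
    (\prod_(i < n.*2) \prod_(j < n.*2 | (i < j)%N)
        (1 + x i ^+ 2 * x j ^+ 2)).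
Proof.
have two_neq0 : 2%:R != 0 :> ratfun K n.*2.
  (* Characteristic zero provides the invertibility of 2 required by Schur's formula. *)
  have two_neq0K : 2%:R != 0 :> K by have /pcharf0P -> := charK0.
  rewrite -tofrac1 -tofracMn; apply: (@tofrac_meval_neq0 _ _ (fun=> 0)).
  by rewrite mevalMn meval1.
have ratC_sqr : ratC n.*2 zeta4 ^+ 2 = -1.
  rewrite /ratC -tofracXn expr2 -mpolyCM -expr2 zeta4_sqrtN1.
  by rewrite mpolyCN mpolyC1 tofracN tofrac1.
have ratCN c : - ratC n.*2 c = ratC n.*2 (- c) by rewrite /ratC mpolyCN tofracN.
have ratCb_neq0 : ratC n.*2 b != 0 by rewrite tofrac_eq0 mpolyC_eq0.
move=> x.
apply: (A2_OO_sqrtN1 (x := x) two_neq0 ratC_sqr ratCb_neq0).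
- exact: ratX_neq0.
- exact: ratX_sqr_affine_neq0.
- by move=> i; rewrite ratCN; apply: ratX_sqr_affine_neq0.
- exact: ratX_sqr_mul_neq0.
- exact: ratX_sqr_sub_neq0.
- exact: n_ge1.
Qed.
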